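(* Let $n$ be a positive integer with $n\equiv 0 \pmod{10}$ and $n\neq 10,160,190$. Then there exists a configuration $(1,5)$ $GDD\left(n,2,6;2n,n-1\right)$.
   Context: A $GDD(n,2,6;\lambda_1,\lambda_2)$ is a finite collection (repetitions allowed) of $6$-element subsets, called blocks, of a $2n$-element set $X$ partitioned into two groups of size $n$, such that every point lies in the same number $r$ of blocks, any two distinct points of the same group lie together in exactly $\lambda_1$ blocks, and any two points from different groups lie together in exactly $\lambda_2$ blocks. It has configuration $(1,5)$ if every block has exactly $1$ point in one of the two groups and $5$ points in the other (which group contains the single point may depend on the block). *)

(* Defs.v *)
From mathcomp Require Import all_boot.

Set Implicit Arguments.
Unset Strict Implicit.
Unset Printing Implicit Defensive.

(* Number of blocks of B, counted with repetition, that contain S.  Throughout,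
   a sequence of sets stands for a multiset: its order plays no role. *)
Definition degree (X : finType) (B : seq {set X}) (S : {set X}) : nat :=
  count (fun b : {set X} => S \subset b) B.

(* (X, P, B) is a GDD(n, m, k; l1, l2); P is the set of groups. *)
Record is_GDD (n m k l1 l2 : nat) (X : finType)
    (P : {set {set X}}) (B : seq {set X}) : Prop := IsGDD {
  gdd_points : #|X| = m * n;
  gdd_partition : partition P [set: X];
  gdd_num_groups : #|P| = m;
  gdd_group_size : forall G : {set X}, G \in P -> #|G| = n;
  gdd_block_size : forall b : {set X}, b \in B -> #|b| = k;
  gdd_replication : exists r : nat, forall x : X, degree B [set x] = r;
  gdd_same_group : forall (G : {set X}) (x y : X),
    G \in P -> x \in G -> y \in G -> x != y -> degree B [set x; y] = l1;
  gdd_diff_groups : forall (G H : {set X}) (x y : X),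
    G \in P -> H \in P -> G != H -> x \in G -> y \in H ->
    degree B [set x; y] = l2
}.

(* For two groups: the choice of G and H may depend on the block b. *)
Definition has_configuration (s t : nat) (X : finType)
    (P : {set {set X}}) (B : seq {set X}) : Prop :=
  forall b : {set X}, b \in B ->
    exists G H : {set X},
      [/\ G \in P, H \in P, G != H, #|b :&: G| = s & #|b :&: H| = t].

(* Main.v *)
Require Import Defs.
From mathcomp Require Import all_boot.
From mathcomp Require Import all_algebra all_field zify.

(** Identify both groups with a set X of size n, and choose for every a in X a
    family L a of 5-subsets of X, so that together the families cover every
    pair of X exactly 2n times.  The blocks are (one copy of a) + (a block of
    L a in the other copy).  A cross pair {a, b} is then covered as often as L a
    covers b plus as often as the family used on the other side for b covers a.
    The two numbers have the same average and an odd sum n - 1, so they cannot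
    both be constant; instead X is cut into two halves, L a covers b either n/2 or n/2 - 1 times according to
    whether a and b lie in the same half, and the families are interchanged
    between the halves on the other side.

    Such "halved" families exist on 10 points, and on 20, 30 and 40 points by
    cutting one parallel class of a resolvable (t,5,4) design in two.  All the
    other blocks may come in classes covering every point 5 times, which are
    much easier to get than parallel classes: every translation orbit of a
    block is such a class.  With difference matrices over GF(q), q >= 5, one
    passes from t to tq points, and with one over Z_10 from 6 and 12 to 60 and
    120 points.  Every multiple of 10 is t times prime powers q >= 5 with t in
    {10, 20, 30, 40, 60, 120}. *)

Set Implicit Arguments.
Unset Strict Implicit.
Unset Printing Implicit Defensive.

Import GRing.Theory.

Definition block (X : finType) := {ffun 'I_5 -> X}.

Definition occ (X : finType) (B : block X) (x : X) : nat := \sum_i (B i == x).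

Definition cov (X : finType) (L : seq (block X)) (x : X) : nat :=
  \sum_(B <- L) occ B x.

Definition pairs (X : finType) (L : seq (block X)) (x y : X) : nat :=
  \sum_(B <- L) occ B x * occ B y.

Definition proper_blocks (X : finType) : pred (seq (block X)) :=
  all (fun B : block X => injectiveb B).

(* A [(#|X|, 5, lam)] design whose blocks are split into classes covering every
   point [k] times; [k = 1] is the usual notion. *)
Definition resolvable (X : finType) (k lam : nat) : Prop :=
  exists Ls : seq (seq (block X)),
    [/\ all (@proper_blocks X) Ls,
        forall L, L \in Ls -> forall x, cov L x = k
      & forall x y, x != y -> pairs (flatten Ls) x y = lam].

(* [L a] covers [x] exactly [#|X| / 2] times if [h a = h x], and one time less
   otherwise.  [f] exchanges the two halves. *)
Definition halved (X : finType) : Prop :=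
  exists (h : X -> bool) (f : X -> X) (L : X -> seq (block X)),
    [/\ injective f, forall x, h (f x) = ~~ h x,
        forall a, proper_blocks (L a),
        forall a x, (cov (L a) x).*2.+2 = #|X| + (h a == h x).*2
      & forall x y, x != y -> \sum_a pairs (L a) x y = 2 * #|X|].

(** * Counting points and pairs in a family of blocks *)

Section Counting.

Variable X : finType.
Implicit Types (B : block X) (L : seq (block X)) (x y : X).

Lemma occ_inj B x : injectiveb B -> occ B x = [exists i, B i == x].
Proof.
move=> /injectiveP injB; rewrite /occ.
case: existsP => [[i /eqP <-]|nex].
  rewrite (bigD1 i) //= eqxx big1 ?addn0 // => j neq.
  by rewrite (inj_eq injB) (negbTE neq).
by apply: big1 => i _; case: eqP => // e; case: nex; exists i; apply/eqP.
Qed.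

Lemma occ_sqr B x : injectiveb B -> occ B x * occ B x = occ B x.
Proof. by move=> injB; rewrite occ_inj //; case: existsP. Qed.

Lemma sum_occ B : \sum_x occ B x = 5.
Proof.
rewrite exchange_big /= -[RHS](card_ord 5) -sum1_card; apply: eq_bigr => i _.
rewrite (bigD1 (B i)) //= eqxx big1 ?addn0 // => j /negbTE.
by rewrite eq_sym => ->.
Qed.

Lemma cov_cat L1 L2 x : cov (L1 ++ L2) x = cov L1 x + cov L2 x.
Proof. exact: big_cat. Qed.

Lemma pairs_cat L1 L2 x y : pairs (L1 ++ L2) x y = pairs L1 x y + pairs L2 x y.
Proof. exact: big_cat. Qed.

Lemma cov_flatten Ls x : cov (flatten Ls) x = \sum_(L <- Ls) cov L x.
Proof. exact: big_flatten. Qed.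

Lemma pairs_flatten Ls x y :
  pairs (flatten Ls) x y = \sum_(L <- Ls) pairs L x y.
Proof. exact: big_flatten. Qed.

(** Each block through [x] has four further points. The proof adds the term [y = x], which equals
    [cov L x] because a proper block meets [x] at most once, and counts five points per block. *)
Lemma sum_pairs L x : proper_blocks L ->
  \sum_(y | y != x) pairs L x y = 4 * cov L x.
Proof.
move=> /allP prL; apply: (@addnI (cov L x)); rewrite -mulSn.
have -> : cov L x + \sum_(y | y != x) pairs L x y = \sum_y pairs L x y.
  rewrite [RHS](bigD1 x) //=; congr (_ + _).
  by apply: eq_big_seq => B BL; rewrite occ_sqr ?prL.
rewrite exchange_big big_distrr /=.
by apply: eq_bigr => B _; rewrite -big_distrr /= sum_occ mulnC.
Qed.

Lemma proper_cat L1 L2 :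
  proper_blocks (L1 ++ L2) = proper_blocks L1 && proper_blocks L2.
Proof. exact: all_cat. Qed.

Lemma proper_flatten Ls :
  proper_blocks (flatten Ls) = all (@proper_blocks X) Ls.
Proof. by elim: Ls => //= L Ls IH; rewrite -IH /proper_blocks all_cat. Qed.

End Counting.

(** * Repeating classes and dealing them out to the points *)

Lemma sum_nseq (T : Type) (c : nat) (s : seq T) (F : T -> nat) :
  \sum_(x <- flatten (nseq c s)) F x = c * \sum_(x <- s) F x.
Proof.
rewrite big_flatten /=; elim: c => [|c IH]; first by rewrite big_nil.
by rewrite big_cons IH mulSn.
Qed.

Lemma mem_flatten_nseq (T : eqType) (c : nat) (s : seq T) (x : T) :
  x \in flatten (nseq c s) -> x \in s.
Proof. by case/flattenP => s' /nseqP[->]. Qed.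

Lemma resolvable_copies (X : finType) (c k lam : nat) :
  resolvable X k lam -> resolvable X k (c * lam).
Proof.
case=> Ls [/allP prL covL pairL]; exists (flatten (nseq c Ls)); split.
- by apply/allP => L /mem_flatten_nseq; apply: prL.
- by move=> L /mem_flatten_nseq; apply: covL.
by move=> x y neq; rewrite pairs_flatten sum_nseq -pairs_flatten pairL.
Qed.

(** Repetition inside each class instead of repetition of classes: parallel classes, with [k = 1],
    become the classes with [k = 5] that the recursive constructions take. *)
Lemma resolvable_merge (X : finType) (c k lam : nat) :
  resolvable X k lam -> resolvable X (c * k) (c * lam).
Proof.
case=> Ls [/allP prL covL pairL].
exists [seq flatten (nseq c L) | L <- Ls]; split.
- apply/allP => _ /mapP[L LLs ->]; rewrite proper_flatten.
  by apply/allP => L' /nseqP[-> _]; apply: prL.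
- by move=> _ /mapP[L LLs ->] x; rewrite /cov sum_nseq -/(cov L x) covL.
move=> x y neq; rewrite pairs_flatten big_map -(pairL _ _ neq) pairs_flatten.
by rewrite big_distrr /=; apply: eq_bigr => L _; rewrite /pairs sum_nseq.
Qed.

Lemma sum_halves (X : finType) (h : X -> bool) (f : X -> X) (b : bool) :
  injective f -> (forall x, h (f x) = ~~ h x) ->
  (\sum_x (h x == b)).*2 = #|X|.
Proof.
move=> injf hf; rewrite -addnn {2}(reindex_inj injf) -big_split /= -sum1_card.
by apply: eq_bigr => x _; rewrite hf; case: (h x) b => [] [].
Qed.

(** Cut [Fs] into [#|X|] consecutive chunks of length [k]; the rank of a point in the enumeration of
    [X] selects its chunk. *)
Lemma deal_classes (X : finType) (T : eqType) (k : nat) (Fs : seq T) :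
  size Fs = #|X| * k -> exists g : X -> seq T,
    [/\ forall a, size (g a) = k, forall a, {subset g a <= Fs}
      & forall H : T -> nat,
        \sum_a \sum_(t <- g a) H t = \sum_(t <- Fs) H t].
Proof.
move=> szF; pose R := reshape (nseq #|X| k) Fs.
have szR : size R = #|X| by rewrite size_reshape size_nseq.
have flR : flatten R = Fs by rewrite reshapeKr // sumn_nseq szF mulnC.
have shR : shape R = nseq #|X| k.
  by rewrite reshapeKl // sumn_nseq szF mulnC.
have ltR (a : X) : enum_rank a < size R by rewrite szR.
exists (fun a => nth [::] R (enum_rank a)); split => [a|a t ta|H].
- by rewrite -(nth_map _ 0) // -/(shape R) shR nth_nseq ltn_ord.
- rewrite -flR; apply/flattenP; exists (nth [::] R (enum_rank a)) => //.
  exact: mem_nth.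
rewrite -flR big_flatten /= (big_nth [::]) big_mkord szR.
by rewrite (reindex (@enum_rank X)) //=; apply: onW_bij; apply: enum_rank_bij.
Qed.

(* Counting the pairs at one point shows that there are exactly [#|X| * k]
   classes in [Fs], so [k] of them can be added to each [L0 a]. *)
Lemma halved_complete (X : finType) (h : X -> bool) (f : X -> X)
    (L0 : X -> seq (block X)) (Fs : seq (seq (block X))) (c k : nat) :
  injective f -> (forall x, h (f x) = ~~ h x) ->
  (forall a, proper_blocks (L0 a)) ->
  (forall a x, cov (L0 a) x = c + (h a == h x)) ->
  all (@proper_blocks X) Fs -> (forall L, L \in Fs -> forall x, cov L x = 5) ->
  (c + 5 * k).+1.*2 = #|X| ->
  (forall x y, x != y ->
     \sum_a pairs (L0 a) x y + pairs (flatten Fs) x y = 2 * #|X|) ->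
  halved X.
Proof.
move=> injf hf prL0 covL0 prF covF cardX pairX.
have szF : size Fs = #|X| * k.
  have /card_gt0P[x _] : 0 < #|X| by rewrite -cardX.
  have cardX1 : #|[pred y | y != x]| = #|X|.-1 by rewrite cardC1.
  have : \sum_(y | y != x) 2 * #|X|
         = 4 * (#|X| * c + \sum_a (h a == h x) + size Fs * 5).
    transitivity (\sum_(y | y != x)
        (\sum_a pairs (L0 a) x y + pairs (flatten Fs) x y)).
      by apply: eq_bigr => y; rewrite eq_sym => neq; rewrite pairX.
    rewrite big_split /= exchange_big /= sum_pairs ?proper_flatten //.
    under eq_bigr => a _ do rewrite sum_pairs // covL0.
    rewrite -big_distrr /= -mulnDr big_split /= sum_nat_const cov_flatten.
    rewrite (@eq_big_seq _ _ _ _ Fs _ (fun=> 5)) => [|L LF]; last by rewrite covF.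
    by rewrite big_const_seq count_predT iter_addn_0 [5 * _]mulnC.
  rewrite sum_nat_const cardX1.
  (* Half of the [N] points agree with [x] under [h], so the count reads
     [2N(N - 1) = 4(Nc + N/2 + 5z)] with [N = 2(c + 5k + 1)], whence [z = Nk]. *)
  have := sum_halves (h x) injf hf; move: cardX => /[swap].
  move: (\sum_(x0 : X) _) => s; move: #|X| (size Fs) => N z; nia.
have [g [szg gF sumg]] := deal_classes szF.
have prg a : proper_blocks (flatten (g a)).
  rewrite proper_flatten; apply/allP => L /gF; apply: (allP prF).
exists h, f, (fun a => L0 a ++ flatten (g a)); split=> // [a|a x|x y neq].
- by rewrite proper_cat prL0 prg.
- rewrite cov_cat covL0 cov_flatten.
  rewrite (@eq_big_seq _ _ _ _ (g a) _ (fun=> 5)) => [|L Lg]; last first.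
    by rewrite covF // (gF a).
  rewrite big_const_seq count_predT iter_addn_0 szg -cardX; lia.
under eq_bigr => a _ do rewrite pairs_cat pairs_flatten.
by rewrite big_split /= sumg -pairs_flatten pairX.
Qed.

(** * Difference matrices and products of designs *)

Definition difference_matrix (G : finZmodType) (K : seq (block G)) (mu : nat) :=
  forall (i j : 'I_5) (d : G), i != j -> \sum_(s <- K) (s i == s j + d)%R = mu.

Definition lift (C : finType) (G : finZmodType) (B : block C) (s : block G)
    (y : G) : block (C * G)%type := [ffun i => (B i, y + s i)%R].

Definition lifts (C : finType) (G : finZmodType) (L : seq (block C))
    (s : block G) : seq (block (C * G)%type) :=
  [seq lift B s y | B <- L, y <- enum G].

Definition place (C G : finType) (z : C) (B : block G) : block (C * G)%type :=
  [ffun i => (z, B i)].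

Definition fill (C G : finType) (L : seq (block G)) : seq (block (C * G)%type) :=
  [seq place z B | z <- enum C, B <- L].

Lemma proper_lifts (C : finType) (G : finZmodType) (L : seq (block C))
    (s : block G) : proper_blocks L -> proper_blocks (lifts L s).
Proof.
move=> /allP prL; apply/allP => _ /allpairsP[[B y] /= [BL _ ->]].
apply/injectiveP => i j; rewrite !ffunE => -[e _].
by have /injectiveP := prL _ BL; apply.
Qed.

Lemma occ_lift (C : finType) (G : finZmodType) (B : block C) (s : block G)
    (y : G) (p : C * G) :
  occ (lift B s y) p = \sum_i (B i == p.1) * (y == p.2 - s i)%R.
Proof.
apply: eq_bigr => i _; rewrite ffunE -pair_eqE /pair_eq /= mulnb.
by rewrite -subr_eq opprK.
Qed.

Lemma sum_eqb (T : finType) (a : T) (F : T -> nat) :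
  \sum_y (y == a) * F y = F a.
Proof.
rewrite (bigD1 a) //= eqxx mul1n big1 ?addn0 // => y /negbTE ->.
exact: mul0n.
Qed.

Lemma sum_eqb1 (T : finType) (a : T) : \sum_y (y == a) = 1.
Proof.
by rewrite -[RHS](sum_eqb a (fun=> 1)); apply: eq_bigr => y _; rewrite muln1.
Qed.

(** For each position [i] with [B i = p.1], exactly one translate [y] puts [p] there, whatever the
    column [s]. *)
Lemma cov_lifts (C : finType) (G : finZmodType) (L : seq (block C))
    (s : block G) (p : C * G) : cov (lifts L s) p = cov L p.1.
Proof.
rewrite /cov big_allpairs_dep; apply: eq_bigr => B _; rewrite big_enum /=.
under eq_bigr => y _ do rewrite occ_lift.
rewrite exchange_big /=; apply: eq_bigr => i _.
by rewrite -big_distrr /= sum_eqb1 muln1.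
Qed.

Lemma eq_subr2 (V : zmodType) (a b x y : V) :
  (a - x == b - y)%R = (x == y + (a - b))%R.
Proof.
apply/eqP/eqP => [e|->].
  by rewrite -[a](subrK x) e addrAC [(b - y)%R]addrC addrK addNKr.
by rewrite opprD opprB addrCA [(a + _)%R]addrC subrK addrC.
Qed.

(** Positions [i] and [j] over [p.1] and [q.1] land on [p] and [q] in one translate if
    [s i - s j = p.2 - q.2], and in none otherwise; for [i != j] this holds for [mu] columns. If
    [p.1 = q.1], properness forces [i = j], and no translate works since [p.2 != q.2]. *)
Lemma pairs_lifts (C : finType) (G : finZmodType) (L : seq (block C))
    (K : seq (block G)) (mu : nat) (p q : C * G) :
  proper_blocks L -> difference_matrix K mu -> p != q ->
  \sum_(s <- K) pairs (lifts L s) p q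
    = if p.1 == q.1 then 0 else mu * pairs L p.1 q.1.
Proof.
move=> /allP prL dmK npq.
transitivity (\sum_(B <- L) \sum_i \sum_j
  (B i == p.1) * (B j == q.1) * \sum_(s <- K) (s i == s j + (p.2 - q.2))%R).
  rewrite /pairs; under eq_bigr => s _ do rewrite big_allpairs_dep.
  rewrite exchange_big /=; apply: eq_bigr => B _.
  transitivity (\sum_(s <- K) \sum_i \sum_j
      (B i == p.1) * (B j == q.1) * (s i == s j + (p.2 - q.2))%R); last first.
    rewrite exchange_big; apply: eq_bigr => i _.
    by rewrite exchange_big; apply: eq_bigr => j _; rewrite big_distrr.
  apply: eq_bigr => s _; rewrite big_enum /=.
  under eq_bigr => y _ do rewrite !occ_lift big_distrlr /=.
  rewrite exchange_big /=; apply: eq_bigr => i _.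
  rewrite exchange_big /=; apply: eq_bigr => j _.
  under eq_bigr => y _ do rewrite mulnACA.
  rewrite -big_distrr /= sum_eqb; congr (_ * nat_of_bool _).
  exact: eq_subr2.
case: ifPn => [/eqP e1|n1]; last first.
  rewrite big_distrr /=; apply: eq_bigr => B _; rewrite /occ big_distrlr /=.
  rewrite big_distrr /=; apply: eq_bigr => i _.
  rewrite big_distrr /=; apply: eq_bigr => j _.
  case: (altP (B i =P p.1)) => [e|]; last by rewrite !mul0n muln0.
  case: (altP (B j =P q.1)) => [e'|]; last by rewrite muln0 mul0n muln0.
  rewrite dmK 1?mulnC //; apply: contraNneq n1 => eij.
  by rewrite -e -e' eij.
have n2 : p.2 != q.2.
  apply: contraNneq npq => e2.
  by rewrite [p]surjective_pairing e1 e2 -surjective_pairing.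
rewrite big_seq big1 // => B BL; rewrite big1 // => i _; rewrite big1 // => j _.
case: (altP (B i =P p.1)) => [e|]; last by rewrite !mul0n.
case: (altP (B j =P q.1)) => [e'|]; last by rewrite muln0 mul0n.
have -> : i = j by have /injectiveP := prL _ BL; apply; rewrite e e' e1.
rewrite big1 // => s _; rewrite -{1}[s j]addr0 (inj_eq (addrI _)) eq_sym.
by rewrite subr_eq0 (negbTE n2).
Qed.

Lemma proper_fill (C G : finType) (L : seq (block G)) :
  proper_blocks L -> proper_blocks (fill C L).
Proof.
move=> /allP prL; apply/allP => _ /allpairsP[[z B] /= [_ BL ->]].
apply/injectiveP => i j; rewrite !ffunE => -[e].
by have /injectiveP := prL _ BL; apply.
Qed.

Lemma occ_place (C G : finType) (z : C) (B : block G) (p : C * G) :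
  occ (place z B) p = (z == p.1) * occ B p.2.
Proof.
rewrite /occ big_distrr /=; apply: eq_bigr => i _.
by rewrite ffunE -pair_eqE /pair_eq /= mulnb.
Qed.

Lemma cov_fill (C G : finType) (L : seq (block G)) (p : C * G) :
  cov (fill C L) p = cov L p.2.
Proof.
rewrite /cov big_allpairs_dep big_enum /=.
rewrite -[RHS](sum_eqb p.1 (fun=> cov L p.2)); apply: eq_bigr => z _.
by rewrite /cov big_distrr /=; apply: eq_bigr => B _; rewrite occ_place.
Qed.

Lemma pairs_fill (C G : finType) (L : seq (block G)) (p q : C * G) :
  pairs (fill C L) p q = if p.1 == q.1 then pairs L p.2 q.2 else 0.
Proof.
rewrite /pairs big_allpairs_dep big_enum /=.
transitivity (\sum_z (z == p.1) * ((z == q.1) * pairs L p.2 q.2)).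
  apply: eq_bigr => z _; rewrite mulnA big_distrr /=; apply: eq_bigr => B _.
  by rewrite !occ_place mulnACA.
by rewrite sum_eqb; case: eqP; rewrite ?mul1n.
Qed.

(** The lifts cover the pairs with distinct first coordinates, the filled copies of [G] the
    remaining pairs. *)
Lemma resolvable_prod (C : finType) (G : finZmodType) (K : seq (block G))
    (mu k lam : nat) :
  difference_matrix K mu -> resolvable C k lam -> resolvable G k (mu * lam) ->
  resolvable (C * G)%type k (mu * lam).
Proof.
move=> dmK [LC [/allP prC covC pairC]] [LG [/allP prG covG pairG]].
exists ([seq lifts L s | L <- LC, s <- K] ++ [seq fill C L | L <- LG]); split.
- apply/allP => L; rewrite mem_cat => /orP[/allpairsP[[L' s] /= [LL' _ ->]]|].
    by apply/proper_lifts/prC.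
  by case/mapP => L' LL' ->; apply/proper_fill/prG.
- move=> L; rewrite mem_cat => /orP[/allpairsP[[L' s] /= [LL' _ ->]]|] p.
    by rewrite cov_lifts covC.
  by case/mapP: p => L' LL' -> p; rewrite cov_fill covG.
move=> p q npq; rewrite pairs_flatten big_cat /= big_allpairs_dep big_map /=.
under eq_big_seq => L LL do rewrite (pairs_lifts (prC _ LL) dmK npq).
under [X in _ + X]eq_bigr => L _ do rewrite pairs_fill.
case: eqP => [e1|/eqP n1].
  rewrite big1 // -pairs_flatten pairG //; apply: contraNneq npq => e2.
  by rewrite [p]surjective_pairing e1 e2 -surjective_pairing.
by rewrite [X in _ + X]big1 // addn0 -big_distrr /= -pairs_flatten pairC.
Qed.

(** * Constructions over a finite field *)

Section Field.

Variable F : finFieldType.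
Variable u : 'I_5 -> F.
Hypothesis inj_u : injective u.

(** A column of the multiplication table of [F], restricted to the five rows [u i]. Columns need not
    be injective: [slope 0] is constant. *)
Definition slope (x : F) : block F := [ffun i => (x * u i)%R].

Lemma slope_eq (i j : 'I_5) (x d : F) : i != j ->
  (slope x i == slope x j + d)%R = (x == d / (u i - u j))%R.
Proof.
move=> nij; have nz : (u i - u j != 0)%R by rewrite subr_eq0 (inj_eq inj_u).
by rewrite !ffunE addrC -subr_eq -mulrBr -[d in LHS](divfK nz) (inj_eq (mulIf nz)).
Qed.

Lemma difference_matrix_slope :
  difference_matrix [seq slope x | x <- enum F] 1.
Proof.
move=> i j d nij; rewrite big_map big_enum /=.
under eq_bigr => x _ do rewrite slope_eq //.
exact: sum_eqb1.
Qed.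

(** The classes are the translation orbits of the nonzero multiples of [u]. For each of the 20
    ordered pairs of positions, a given nonzero difference arises from exactly one multiplier
    [x]. *)
Lemma resolvable_field : resolvable F 5 20.
Proof.
pose line (x : F) := [seq [ffun i => (y + slope x i)%R] : block F | y <- enum F].
have occ_line (x y p : F) : occ ([ffun i => (y + slope x i)%R] : block F) p
    = \sum_i (y == p - slope x i)%R.
  by apply: eq_bigr => i _; rewrite ffunE -subr_eq opprK.
exists [seq line x | x <- enum F & x != 0%R]; split.
- apply/allP => L /mapP[x]; rewrite mem_filter => /andP[nz _] {L}->.
  apply/allP => _ /mapP[y _ ->]; apply/injectiveP => i j; rewrite !ffunE.
  by move/addrI/(mulfI nz)/inj_u.
- move=> _ /mapP[x _ ->] p; rewrite /cov big_map big_enum /=.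
  under eq_bigr => y _ do rewrite occ_line.
  rewrite exchange_big /=; under eq_bigr => i _ do rewrite sum_eqb1.
  by rewrite sum1_card card_ord.
move=> p q npq; rewrite pairs_flatten big_map big_filter big_enum_cond /=.
transitivity (\sum_(i < 5) \sum_(j < 5)
    \sum_(x | x != 0%R) (slope x i == slope x j + (p - q))%R).
  transitivity (\sum_(x | x != 0%R) \sum_(i < 5) \sum_(j < 5)
      (slope x i == slope x j + (p - q))%R); last first.
    by rewrite exchange_big; apply: eq_bigr => i _; rewrite exchange_big.
  apply: eq_bigr => x _; rewrite /pairs big_map big_enum /=.
  under eq_bigr => y _ do rewrite !occ_line big_distrlr /=.
  rewrite exchange_big /=; apply: eq_bigr => i _.
  rewrite exchange_big /=; apply: eq_bigr => j _.
  by rewrite sum_eqb eq_subr2.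
transitivity (\sum_(i < 5) \sum_(j < 5) (i != j)); last first.
  by rewrite !big_ord_recr !big_ord0.
apply: eq_bigr => i _; apply: eq_bigr => j _.
have [<-|nij] := altP (i =P j).
  rewrite big1 // => x _; rewrite -[X in X == _]addr0 (inj_eq (addrI _)) eq_sym.
  by rewrite subr_eq0 (negbTE npq).
under eq_bigr => x _ do rewrite slope_eq //.
have nz : ((p - q) / (u i - u j) != 0)%R.
  by rewrite mulf_neq0 ?invr_eq0 ?subr_eq0 // (inj_eq inj_u).
rewrite (bigD1 ((p - q) / (u i - u j))%R) //= eqxx big1 ?addn0 // => x /andP[_].
by move/negbTE ->.
Qed.

(** There are as many columns as elements of [F], so the point [(a, r)] receives the lifts of [L a]
    along its own column [slope r]. Over all points, these cover each pair with distinct first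
    coordinates [2 * #|C|] times. *)
Lemma halved_field (C : finType) : 0 < #|C| -> 10 %| #|C| ->
  halved C -> resolvable C 5 (2 * #|C|) -> halved (C * F)%type.
Proof.
move=> C_gt0 /dvdnP[t cardC] [h [f [L [injf hf prL covL pairL]]]] resC.
(* Pairs with distinct first coordinates still need [(#|F| - 1) * (2 * #|C|)] coverings; the other
   pairs need all [2 * #|C| * #|F| = t * #|F| * 20]. *)
have [LC [/allP prC covC pairC]] := resolvable_copies (#|F|.-1) resC.
have [LF [/allP prF covF pairF]] := resolvable_copies (t * #|F|) resolvable_field.
have F_gt0 : 0 < #|F| by apply/card_gt0P; exists 0%R.
pose K := [seq slope x | x <- enum F].
pose Fs := [seq lifts L s | L <- LC, s <- K] ++ [seq fill C L | L <- LF].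
apply: (@halved_complete _ (fun p => h p.1) (fun p => (f p.1, p.2))
  (fun p => lifts (L p.1) (slope p.2)) Fs (t * 5).-1 (t * #|F|.-1)) => //=.
- by move=> [a r] [b v] /= [/injf -> ->].
- by move=> p; apply: proper_lifts.
- move=> a p; rewrite cov_lifts; have := covL a.1 p.1.
  move: C_gt0; rewrite cardC; case: (_ == _) => /=; lia.
- apply/allP => L'; rewrite mem_cat => /orP[/allpairsP[[L1 s] /= [LL _ ->]]|].
    by apply/proper_lifts/prC.
  by case/mapP => L1 LL ->; apply/proper_fill/prF.
- move=> L'; rewrite mem_cat => /orP[/allpairsP[[L1 s] /= [LL _ ->]]|] p.
    by rewrite cov_lifts covC.
  by case/mapP: p => L1 LL -> p; rewrite cov_fill covF.
- by move: C_gt0; rewrite card_prod cardC; move: #|F| F_gt0 => m; nia.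
move=> p q npq; rewrite pairs_flatten big_cat /= big_allpairs_dep big_map /=.
under [X in _ + (X + _)]eq_big_seq => L' LL do
  rewrite (pairs_lifts (prC _ LL) difference_matrix_slope npq).
under [X in _ + (_ + X)]eq_bigr => L' _ do rewrite pairs_fill.
rewrite -(pair_bigA _ (fun a r => pairs (lifts (L a) (slope r)) p q)) /=.
have -> : \sum_a \sum_r pairs (lifts (L a) (slope r)) p q
    = \sum_a \sum_(s <- K) pairs (lifts (L a) s) p q.
  by apply: eq_bigr => a _; rewrite big_map big_enum.
under eq_bigr => a _ do
  rewrite (pairs_lifts (prL a) difference_matrix_slope npq).
rewrite card_prod.
case: eqP => [e1|/eqP n1].
  rewrite [X in X + _]big1 // [X in _ + (X + _)]big1 // !add0n.
  rewrite -pairs_flatten pairF; last first.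
    apply: contraNneq npq => e2.
    by rewrite [p]surjective_pairing e1 e2 -surjective_pairing.
  have arith m : t * m * 20 = 2 * (t * 10 * m) by lia.
  by rewrite cardC; apply: arith.
rewrite [X in _ + (_ + X)]big1 // addn0 -!big_distrr /= -pairs_flatten pairC //.
have arith c m : 0 < m -> 1 * (2 * c) + 1 * (m.-1 * (2 * c)) = 2 * (c * m).
  by case: m => //= m _; nia.
by rewrite pairL //; apply: arith.
Qed.

End Field.

(** Now the second coordinate defines the halves: the filled copies of the family on [G] settle all
    pairs with equal first coordinates, and the lifts serve only as added classes for the other
    pairs. *)
Lemma halved_cells (C : finType) (G : finZmodType) (K : seq (block G)) :
  #|G| = 10 -> 0 < #|C| -> 6 %| #|C| -> difference_matrix K 6 ->
  resolvable C 5 20 -> halved G -> halved (C * G)%type.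
Proof.
move=> cardG C_gt0 /dvdnP[t cardC] dmK resC [h [f [L [injf hf prL covL pairL]]]].
(* With [#|C| = t * 6], the lifts of [t] copies cover a pair [6 * (t * 20) = 2 * (#|C| * 10)]
   times. *)
have [LC [/allP prC covC pairC]] := resolvable_copies t resC.
apply: (@halved_complete _ (fun p => h p.2) (fun p => (p.1, f p.2))
  (fun p => fill C (L p.2)) [seq lifts L s | L <- LC, s <- K] 4 #|C|.-1) => //=.
- by move=> [a r] [b v] /= [-> /injf ->].
- by move=> p; apply: proper_fill.
- move=> a p; rewrite cov_fill; have := covL a.2 p.2.
  by rewrite cardG; case: (_ == _) => /=; lia.
- by apply/allP => L' /allpairsP[[L1 s] /= [LL _ ->]]; apply/proper_lifts/prC.
- by move=> L' /allpairsP[[L1 s] /= [LL _ ->]] p; rewrite cov_lifts covC.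
- by rewrite card_prod cardG; case: #|C| C_gt0 => //= m _; lia.
move=> p q npq; rewrite pairs_flatten big_allpairs_dep /=.
under [X in _ + X]eq_big_seq => L' LL do rewrite (pairs_lifts (prC _ LL) dmK npq).
rewrite -(pair_bigA _ (fun a r => pairs (fill C (L r)) p q)) /=.
under eq_bigr => a _ do under eq_bigr => r _ do rewrite pairs_fill.
rewrite sum_nat_const card_prod cardG.
case: eqP => [e1|/eqP n1].
  rewrite [X in _ + X]big1 // addn0 pairL.
    have arith m : m * (2 * 10) = 2 * (m * 10) by lia.
    by rewrite cardG; apply: arith.
  apply: contraNneq npq => e2.
  by rewrite [p]surjective_pairing e1 e2 -surjective_pairing.
rewrite [X in _ * X]big1 // muln0 -big_distrr /= -pairs_flatten pairC //.
have arith : 6 * (t * 20) = 2 * (t * 6 * 10) by lia.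
by rewrite cardC; apply: arith.
Qed.

(** * Designs given as lists of numbers and checked by evaluation *)

Section Lists.

Variable n : nat.
Implicit Types (s : seq nat) (Bs : seq (seq nat)).

Definition list_block s : block 'I_n.+1 := [ffun i : 'I_5 => inord (nth 0 s i)].

Definition five_points s := [&& size s == 5, uniq s & all (leq^~ n) s].

Definition covers (k : nat -> nat) Bs :=
  all (fun x => count (fun s => x \in s) Bs == k x) (iota 0 n.+1).

(** The blocks through [x] are selected once, before [y] varies, to shorten the evaluation. *)
Definition balanced (lam : nat) Bs :=
  all (fun x => let Bx := [seq s <- Bs | x \in s] in
    all (fun y => (x == y) || (count (fun s => y \in s) Bx == lam))
      (iota 0 n.+1)) (iota 0 n.+1).

Lemma proper_list_block Bs :
  all five_points Bs -> proper_blocks (map list_block Bs).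
Proof.
move=> /allP ok; apply/allP => _ /mapP[s /ok/and3P[/eqP sz us /allP les] ->].
apply/injectiveP => i j; rewrite !ffunE => /(congr1 val) /=.
rewrite !inordK ?ltnS ?les ?mem_nth ?sz // => /eqP.
by rewrite nth_uniq ?sz // => /eqP/val_inj.
Qed.

Lemma occ_list_block s (x : 'I_n.+1) :
  five_points s -> occ (list_block s) x = (val x \in s).
Proof.
case/and3P => /eqP sz us /allP les.
transitivity (\sum_(i < 5) (nth 0 s i == x)).
  apply: eq_bigr => i _; rewrite ffunE -val_eqE /= inordK //.
  by rewrite ltnS les ?mem_nth ?sz.
rewrite -(count_uniq_mem _ us) -sum1_count [RHS]big_mkcond (big_nth 0) big_mkord sz.
by apply: eq_bigr => i _ /=; rewrite eq_sym; case: (_ == _).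
Qed.

Lemma cov_list_block Bs (x : 'I_n.+1) : all five_points Bs ->
  cov (map list_block Bs) x = count (fun s => val x \in s) Bs.
Proof.
move=> /allP ok; rewrite /cov big_map -sum1_count [RHS]big_mkcond /=.
by apply: eq_big_seq => s /ok/occ_list_block ->; case: ifP.
Qed.

Lemma pairs_list_block Bs (x y : 'I_n.+1) : all five_points Bs ->
  pairs (map list_block Bs) x y
    = count (fun s => val y \in s) [seq s <- Bs | val x \in s].
Proof.
move=> /allP ok; rewrite /pairs big_map count_filter -sum1_count [RHS]big_mkcond /=.
apply: eq_big_seq => s /ok sok; rewrite !occ_list_block //.
by case: (_ \in s); case: (_ \in s).
Qed.

Lemma cov_covers Bs k (x : 'I_n.+1) : all five_points Bs -> covers k Bs ->
  cov (map list_block Bs) x = k x.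
Proof.
move=> ok /allP cb; rewrite cov_list_block //; apply/eqP/cb.
by rewrite mem_iota ltn_ord.
Qed.

Lemma pairs_balanced Bs lam (x y : 'I_n.+1) : all five_points Bs ->
  balanced lam Bs -> x != y -> pairs (map list_block Bs) x y = lam.
Proof.
move=> ok /allP bal nxy; have mo (z : 'I_n.+1) : val z \in iota 0 n.+1.
  by rewrite mem_iota ltn_ord.
rewrite pairs_list_block //; apply/eqP.
by have /allP/(_ _ (mo y)) := bal _ (mo x); rewrite val_eqE (negbTE nxy).
Qed.

Lemma resolvable_list (k lam : nat) (Ps : seq (seq (seq nat))) :
  all (all five_points) Ps -> all (covers (fun=> k)) Ps ->
  balanced lam (flatten Ps) -> resolvable 'I_n.+1 k lam.
Proof.
move=> /allP ok /allP cP bal; exists [seq map list_block Bs | Bs <- Ps].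
split=> [|_ /mapP[Bs BsP ->] x|x y nxy].
- by apply/allP => _ /mapP[Bs BsP ->]; apply/proper_list_block/ok.
- by rewrite (cov_covers _ (ok _ BsP) (cP _ BsP)).
rewrite -map_flatten (pairs_balanced _ bal nxy) //; apply/allP => s /flattenP[Bs BsP].
by apply/allP/ok.
Qed.

(** Two families suffice, one per half, each used at [m] points; a pair is then covered
    [m * 4 = 2 * (2 * m)] times. *)
Lemma halved_list (m : nat) (L1 L2 : seq (seq nat)) :
  n.+1 = m.*2 -> all five_points L1 -> all five_points L2 ->
  covers (fun x => m.-1 + (x < m)) L1 -> covers (fun x => m.-1 + (m <= x)) L2 ->
  balanced 4 (L1 ++ L2) -> halved 'I_n.+1.
Proof.
move=> nm ok1 ok2 c1 c2 bal; pose h (x : 'I_n.+1) := x < m.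
have hf x : h (rev_ord x) = ~~ h x.
  by rewrite /h /= -leqNgt; have := ltn_ord x; lia.
pose L (a : 'I_n.+1) := map list_block (if h a then L1 else L2).
exists h, (@rev_ord _), L; split=> // [|a|a x|x y nxy].
- exact: rev_ord_inj.
- by rewrite /L; case: ifP => _; apply: proper_list_block.
- rewrite card_ord.
  suff : (cov (L a) x).*2.+2 = m.*2 + (h a == h x).*2 by rewrite -nm.
  have m_gt0 : 0 < m by lia.
  rewrite /L; case: (h a).
    rewrite (cov_covers x ok1 c1) /h; case: (x < m) => /=; lia.
  rewrite (cov_covers x ok2 c2) /h ltnNge; case: (m <= x) => /=; lia.
have := pairs_balanced (x := x) (y := y) _ bal nxy.
rewrite all_cat ok1 ok2 map_cat pairs_cat => /(_ isT) e.
transitivity (\sum_(a : 'I_n.+1) ((h a == true) * pairs (map list_block L1) x y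
    + (h a == false) * pairs (map list_block L2) x y)).
  by apply: eq_bigr => a _; rewrite /L; case: (h a) => /=; lia.
rewrite big_split /= -!big_distrl /=.
have := sum_halves true (@rev_ord_inj _) hf.
have := sum_halves false (@rev_ord_inj _) hf.
rewrite card_ord; move: (pairs _ x y) (pairs _ x y) (\sum__ _) (\sum__ _) e.
by move=> a b c d; nia.
Qed.

End Lists.

(** * The orders 10, 20, 30, 40, 60 and 120 *)

Definition good_order (t : nat) : Prop :=
  exists X : finType, [/\ #|X| = t, halved X & resolvable X 5 (2 * t)].

(* The point [v] is the point at infinity.  Renaming the points along
   [flatten base] makes [rotation v base 0] the partition of 0, 1, 2, ... into
   consecutive blocks, so that its halves cover the two halves of the points. *)
Definition rotation (v : nat) (base : seq (seq nat)) (s : nat) :=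
  [seq [seq index (if x == v then v else (x + s) %% v) (flatten base) | x <- b]
     | b <- base].

Definition rotations v base r s := flatten [seq rotation v base i | i <- iota r s].

(** Rotation 0 is cut into its first and last [t] blocks, and the other [2(5t - 1)] rotations are
    shared equally. Each family thus covers one half of the points [5t] times and the other [5t - 1]
    times. *)
Lemma good_order_rotation (t : nat) (base : seq (seq nat)) :
  let v := (10 * t).-1 in
  let Ps := [seq rotation v base s | s <- iota 0 v] in
  let L1 := take t (rotation v base 0) ++ rotations v base 1 (5 * t).-1 in
  let L2 := drop t (rotation v base 0) ++ rotations v base (5 * t) (5 * t).-1 in
  0 < t -> all (all (five_points v)) Ps -> all (covers v (fun=> 1)) Ps ->
  balanced v 4 (flatten Ps) ->
  covers v (fun x => (5 * t).-1 + (x < 5 * t)) L1 ->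
  covers v (fun x => (5 * t).-1 + (5 * t <= x)) L2 ->
  balanced v 4 (L1 ++ L2) -> good_order (10 * t).
Proof.
move=> v Ps L1 L2 t_gt0 ok c bal c1 c2 bal12.
have vt : v.+1 = 10 * t by rewrite /v prednK // muln_gt0.
have okr s : s < v -> all (five_points v) (rotation v base s).
  by move=> lt; apply: (allP ok); apply: map_f; rewrite mem_iota.
have okrs r s : r + s <= v -> all (five_points v) (rotations v base r s).
  move=> le; apply/allP => b /flattenP[_ /mapP[i + ->]].
  rewrite mem_iota => ii; apply/allP/okr; lia.
have ok0 : all (five_points v) (rotation v base 0) by apply: okr; lia.
exists 'I_v.+1; rewrite -vt; split; first exact: card_ord.
  apply: (@halved_list _ (5 * t) L1 L2) => //; first by lia.
    rewrite all_cat okrs ?andbT; last by lia.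
    by apply/allP => b /mem_take; apply/allP.
  rewrite all_cat okrs ?andbT; last by lia.
  by apply/allP => b /mem_drop; apply/allP.
(* Each parallel class is repeated five times, then the whole list of classes [t] times. *)
have -> : 2 * v.+1 = t * (5 * 4) by lia.
have res := resolvable_merge 5 (resolvable_list ok c bal).
exact: (resolvable_copies t res).
Qed.

(** Here and in the next two classes the largest entry is the point at infinity. The differences of
    the finite entries within blocks represent each nonzero residue modulo 19, 29 or 39 four
    times. *)
Definition base20 :=
  [:: [:: 5; 7; 13; 6; 9]; [:: 4; 11; 3; 14; 17]; [:: 10; 8; 15; 1; 0];
      [:: 18; 12; 2; 16; 19]].

Definition base30 :=
  [:: [:: 2; 0; 5; 20; 1]; [:: 18; 8; 22; 26; 10]; [:: 25; 6; 9; 23; 15];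
      [:: 11; 19; 17; 24; 12]; [:: 21; 14; 27; 28; 3]; [:: 16; 4; 13; 7; 29]].

Definition base40 :=
  [:: [:: 29; 14; 33; 11; 2]; [:: 23; 37; 21; 8; 7]; [:: 1; 25; 19; 12; 18];
      [:: 35; 17; 15; 28; 5]; [:: 36; 31; 9; 16; 13]; [:: 0; 30; 38; 10; 4];
      [:: 24; 22; 26; 27; 32]; [:: 20; 6; 3; 34; 39]].

Lemma good_order20 : good_order 20.
Proof. by apply: (@good_order_rotation 2 base20); vm_compute. Qed.

Lemma good_order30 : good_order 30.
Proof. by apply: (@good_order_rotation 3 base30); vm_compute. Qed.

Lemma good_order40 : good_order 40.
Proof. by apply: (@good_order_rotation 4 base40); vm_compute. Qed.

Definition develop (v : nat) (base : seq (seq nat)) :=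
  [seq [seq [seq (x + s) %% v | x <- b] | s <- iota 0 v] | b <- base].

(** The six translates of [iota 0 5] are all the 5-subsets of six points; a pair lies in four of
    them. *)
Lemma resolvable6 : resolvable 'I_6 5 20.
Proof.
have : resolvable 'I_6 5 4.
  by apply: (@resolvable_list 5 5 4 (develop 6 [:: iota 0 5])); vm_compute.
exact: resolvable_copies 5 5 4.
Qed.

(** Eleven base blocks, because each has 20 ordered differences and each of the eleven nonzero
    residues must occur 20 times. Modulo 10, nine are required for the same reason. *)
Lemma resolvable12 : resolvable 'I_12 5 20.
Proof.
by apply: (@resolvable_list 11 5 20 (develop 12
  [:: [:: 0; 4; 6; 7; 9]; [:: 0; 1; 2; 5; 7]; [:: 0; 1; 2; 5; 11];
      [:: 0; 2; 4; 7; 11]; [:: 0; 1; 2; 6; 11]; [:: 0; 4; 5; 8; 10];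
      [:: 0; 2; 3; 4; 6]; [:: 0; 5; 6; 9; 11]; [:: 0; 1; 5; 6; 9];
      [:: 0; 2; 3; 4; 7]; [:: 0; 1; 4; 8; 10]])); vm_compute.
Qed.

Lemma resolvable10 : resolvable 'I_10 5 20.
Proof.
by apply: (@resolvable_list 9 5 20 (develop 10
  [:: [:: 0; 3; 7; 8; 9]; [:: 0; 1; 4; 5; 8]; [:: 0; 1; 3; 7; 9];
      [:: 0; 3; 5; 8; 9]; [:: 0; 4; 6; 7; 8]; [:: 0; 1; 2; 5; 6];
      [:: 0; 5; 7; 8; 9]; [:: 0; 3; 4; 5; 7]; [:: 0; 1; 3; 5; 8]])); vm_compute.
Qed.

Lemma halved10 : halved 'I_10.
Proof.
pose L := [:: [:: 1; 4; 5; 7; 9]; [:: 0; 4; 5; 6; 8]; [:: 0; 1; 3; 7; 8];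
  [:: 1; 2; 3; 5; 8]; [:: 3; 4; 6; 8; 9]; [:: 0; 2; 3; 4; 9];
  [:: 2; 3; 5; 6; 7]; [:: 0; 1; 2; 4; 7]; [:: 0; 1; 2; 6; 9]].
(* The reflection [x -> 9 - x] exchanges the halves, so the mirror image of [L] serves as the second
   family. *)
by apply: (@halved_list 9 5 L [seq map (subn 9) b | b <- L]); vm_compute.
Qed.

Lemma good_order10 : good_order 10.
Proof.
by exists 'I_10; split; [apply: card_ord | apply: halved10 | apply: resolvable10].
Qed.

(* {1, 3, 4, 5, 9} is a (11,5,2) difference set, so two rows of the 12-column
   matrix [paley] agree in exactly 6 columns. *)
Definition paley (i j : nat) : nat :=
  (j < 11) && ((j + 11 - i) %% 11 \in [:: 1; 3; 4; 5; 9]).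

(* By the Chinese remainder theorem: [paley] mod 2, multiplication mod 5. *)
Definition entry (i : nat) (p : nat * nat) := 5 * paley i p.1 + 6 * (i * p.2).

Definition columns := [seq (j, x) | j <- iota 0 12, x <- iota 0 5].

Lemma difference_matrix10 : exists K : seq (block 'I_10), difference_matrix K 6.
Proof.
exists [seq [ffun i : 'I_5 => inZp (entry i p)] | p <- columns] => i j d nij.
have cols : all (fun i => all (fun j => all (fun d =>
    (i == j) || (count (fun p => entry i p %% 10 == (entry j p %% 10 + d) %% 10)
      columns == 6)) (iota 0 10)) (iota 0 5)) (iota 0 5) by vm_compute.
(* Generalizing [columns] keeps the simplifications below from expanding its sixty entries. *)
move: columns cols => cs cols.
have mo (m : nat) (k : 'I_m) : val k \in iota 0 m by rewrite mem_iota ltn_ord.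
have := allP (allP (allP cols _ (mo _ i)) _ (mo _ j)) _ (mo _ d).
rewrite val_eqE (negbTE nij) /= => /eqP e; rewrite -[RHS]e big_map -sum1_count.
rewrite [RHS]big_mkcond /=; apply: eq_bigr => p _; rewrite !ffunE -val_eqE /=.
by case: (_ == _).
Qed.

Lemma good_order_cells (s : nat) :
  0 < s -> 6 %| s -> resolvable 'I_s 5 20 -> good_order (10 * s).
Proof.
move=> s_gt0 s6 res_s; have [K dmK] := difference_matrix10.
exists ('I_s * 'I_10)%type; split; first by rewrite card_prod !card_ord mulnC.
  by apply: halved_cells halved10; rewrite ?card_ord //; apply: dmK.
have [c sc] := dvdnP s6.
have -> : 2 * (10 * s) = c * (6 * 20) by lia.
apply/resolvable_copies/(@resolvable_prod _ _ _ _ _ _ dmK res_s).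
exact: resolvable_copies resolvable10.
Qed.

(** * Recursion over prime-power factors *)

Lemma good_order_field (t p k : nat) :
  prime p -> 5 <= p ^ k -> 0 < t -> 10 %| t -> good_order t ->
  good_order (t * p ^ k).
Proof.
move=> pr_p q5 t_gt0 t10 [X [cardX halfX resX]].
have k_gt0 : 0 < k by case: k q5.
have [F _ cardF] := pPrimePowerField pr_p k_gt0.
have F5 : 5 <= #|F| by rewrite cardF.
(* Five distinct field elements: the first five in the enumeration of [F]. *)
pose u (i : 'I_5) : F := enum_val (widen_ord F5 i).
have inj_u : injective u.
  by move=> i j /enum_val_inj/(congr1 val)/= /val_inj.
exists (X * F)%type; split; first by rewrite card_prod cardX cardF.
  by apply: (halved_field inj_u); rewrite ?cardX.
have -> : 2 * (t * p ^ k) = 1 * (#|F| * (2 * t)) by rewrite cardF; lia.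
have [c tc] := dvdnP t10.
apply: (resolvable_prod (difference_matrix_slope inj_u)).
  exact: resolvable_copies.
have -> : 1 * (#|F| * (2 * t)) = #|F| * c * 20 by rewrite tc; lia.
exact/resolvable_copies/(resolvable_field inj_u).
Qed.

Lemma good_order_small (m : nat) : m %| 12 -> good_order (10 * m).
Proof.
move=> m12; have : m \in divisors 12 by rewrite -dvdn_divisors.
have -> : divisors 12 = [:: 1; 2; 3; 4; 6; 12] by [].
rewrite !inE => /or4P[/eqP->|/eqP->|/eqP->|/or3P[]/eqP->].
- exact: good_order10.
- exact: good_order20.
- exact: good_order30.
- exact: good_order40.
- exact: good_order_cells resolvable6.
- exact: good_order_cells resolvable12.
Qed.

(** Induction removing a full prime-power component of size at least 5. Taking it whole matters: 8
    can be removed at once, but not as 2 times 4. *)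
Lemma good_order_all (m : nat) : 0 < m -> good_order (10 * m).
Proof.
have [N] := ubnP m; elim: N m => // N IH m /ltnSE lemN m_gt0.
have [/hasP[p]|/hasPn small] := boolP (has (fun p => 5 <= p ^ logn p m) (primes m)).
  rewrite mem_primes => /and3P[pr_p _ p_m] q5.
  have q_m : p ^ logn p m %| m by apply: pfactor_dvdnn.
  move: (logn p m) q5 q_m => k q5 q_m.
  have q_gt1 : 1 < p ^ k by apply: leq_trans q5.
  have mq_gt0 : 0 < m %/ p ^ k.
    by rewrite (divn_gt0 _ (ltnW q_gt1)) (dvdn_leq m_gt0 q_m).
  rewrite -(divnK q_m) mulnA; apply: good_order_field => //.
  - by rewrite muln_gt0.
  - exact: dvdn_mulr.
  by apply: IH => //; apply: leq_trans lemN; apply: ltn_Pdiv.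
(* Every prime-power component is now 2, 3 or 4, hence divides 12. *)
apply: good_order_small; apply/dvdn_partP => // p p_m; rewrite p_part.
have pr_p : prime p by move: p_m; rewrite mem_primes => /and3P[].
have := small p p_m; rewrite -ltnNge ltnS.
move: (logn p m) => k; have [->|k_gt0] := posnP k; first by [].
have p_gt1 := prime_gt1 pr_p => le4.
have p4 : p <= 4 by apply: leq_trans le4; rewrite -{1}[p]expn1 leq_exp2l.
have k2 : k <= 2.
  rewrite leqNgt; apply: contraTN le4 => k3; rewrite -ltnNge.
  have p3 : 2 ^ 3 <= p ^ 3 by rewrite leq_exp2r.
  exact: leq_trans (leq_trans (isT : 4 < 2 ^ 3) p3) (leq_pexp2l (ltnW p_gt1) k3).
by move: p k pr_p p4 k2 k_gt0 le4 {p_m p_gt1}; do 5?[case=> //]; do 3?[case=> //].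
Qed.

(** * From a halved family to the group divisible design *)

Section Construction.

Variable X : finType.
Variables (h : X -> bool) (f : X -> X) (L : X -> seq (block X)).
Hypothesis inj_f : injective f.
Hypothesis h_f : forall x, h (f x) = ~~ h x.
Hypothesis proper_L : forall a, proper_blocks (L a).
Hypothesis cov_L :
  forall a x, (cov (L a) x).*2.+2 = #|X| + (h a == h x).*2.
Hypothesis pairs_L :
  forall x y, x != y -> \sum_a pairs (L a) x y = 2 * #|X|.

Definition group_of (c : bool) : {set bool * X} := [set p | p.1 == c].

Definition cone (c : bool) (a : X) (B : block X) : {set bool * X} :=
  (c, a) |: [set (~~ c, B i) | i : 'I_5].

(* Composing with [f] makes the two coverings of a cross pair complementary. *)
Definition link (c : bool) (a : X) : seq (block X) := if c then L a else L (f a).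

Definition design : seq {set bool * X} :=
  [seq cone true a B | a <- enum X, B <- link true a]
  ++ [seq cone false a B | a <- enum X, B <- link false a].

Lemma proper_link c a : proper_blocks (link c a).
Proof. by case: c; apply: proper_L. Qed.

Lemma mem_cone (c c' : bool) (a y : X) (B : block X) : injectiveb B ->
  (((c', y) \in cone c a B) : nat) = if c' == c then y == a : nat else occ B y.
Proof.
move=> injB; rewrite in_setU1 xpair_eqE; case: eqP => [->|] /=.
  rewrite (_ : _ \in _ = false) ?orbF //; apply/negbTE/imsetP => -[i _ []].
  by case: c.
move=> nc; rewrite occ_inj //; congr (nat_of_bool _).
have -> : c' = ~~ c by case: c c' nc => [] [].
apply/imsetP/existsP => [[i _ [->]]|[i /eqP <-]]; first by exists i.
by exists i.
Qed.

Lemma degree_design (S : {set bool * X}) : degree design S =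
  \sum_a \sum_(B <- link true a) (S \subset cone true a B)
  + \sum_a \sum_(B <- link false a) (S \subset cone false a B).
Proof.
have count_sum c : count (fun b : {set bool * X} => S \subset b)
    [seq cone c a B | a <- enum X, B <- link c a]
    = \sum_a \sum_(B <- link c a) (S \subset cone c a B).
  rewrite -sum1_count big_mkcond big_allpairs_dep big_enum /=.
  by apply: eq_bigr => a _; apply: eq_bigr => B _; case: (_ \subset _).
by rewrite /degree count_cat !count_sum.
Qed.

Lemma degree_side (c : bool) (S : {set bool * X}) : degree design S =
  \sum_a \sum_(B <- link c a) (S \subset cone c a B)
  + \sum_a \sum_(B <- link (~~ c) a) (S \subset cone (~~ c) a B).
Proof. by rewrite degree_design; case: c; last rewrite addnC. Qed.

Lemma cov_link (c : bool) (a x : X) :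
  (cov (link c a) x).*2.+2 = #|X| + (c == (h a == h x)).*2.
Proof.
by case: c; rewrite cov_L //= ?h_f; case: (h a) (h x) => [] [].
Qed.

(** With [N = #|X|], half of the points [a] contribute [N/2] and the other half [N/2 - 1]. *)
Lemma sum_cov_link (c : bool) (x : X) :
  (\sum_a cov (link c a) x).*2 = #|X| * (#|X|.-1).
Proof.
have e : (\sum_a cov (link c a) x).*2 + #|X| * 2
    = #|X| * #|X| + (\sum_a (h a == (c == h x))).*2.
  rewrite -!muln2 -!sum_nat_const !big_distrl -!big_split /=.
  apply: eq_bigr => a _; have := cov_link c a x.
  by case: c (h a) (h x) => [] [] []; rewrite /= -?muln2; lia.
move: e; rewrite (sum_halves _ inj_f h_f).
by case: #|X| => [|m] /= e; nia.
Qed.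

Lemma pairs_link (c : bool) (x y : X) : x != y ->
  \sum_a pairs (link c a) x y = 2 * #|X|.
Proof.
by move=> nxy; case: c; rewrite -(pairs_L nxy) //= [RHS](reindex_inj inj_f).
Qed.

Lemma subset2 (T : finType) (p q : T) (A : {set T}) :
  ([set p; q] \subset A) = (p \in A) * (q \in A) :> nat.
Proof. by rewrite subUset !sub1set mulnb. Qed.

(** A cone has only its apex in its own group, so only cones with apex in the other group contain
    both points. *)
Lemma degree_same (c : bool) (x y : X) : x != y ->
  degree design [set (c, x); (c, y)] = 2 * #|X|.
Proof.
move=> nxy; rewrite (degree_side (~~ c)) negbK -(pairs_link (~~ c) nxy).
rewrite [X in _ + X]big1 ?addn0 => [|a _]; last first.
  rewrite big_seq big1 // => B /(allP (proper_link _ _)) injB.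
  rewrite subset2 !mem_cone // eqxx mulnb; case: eqP => //= <-.
  by rewrite eq_sym (negbTE nxy).
apply: eq_bigr => a _; apply: eq_big_seq => B /(allP (proper_link _ _)) injB.
by rewrite subset2 !mem_cone //; case: c {injB}.
Qed.

(** A cone containing both points has one of them as apex. By [cov_link] exactly one of the two
    choices has the extra unit, so the total is [N/2 + (N/2 - 1)] with [N = #|X|]. *)
Lemma degree_cross (c : bool) (x y : X) :
  degree design [set (c, x); (~~ c, y)] = #|X| - 1.
Proof.
rewrite (degree_side c).
have side c1 c2 u v : c2 = ~~ c1 -> \sum_a \sum_(B <- link c1 a)
    ([set (c1, u); (c2, v)] \subset cone c1 a B) = cov (link c1 u) v.
  move=> ->; rewrite -[RHS](sum_eqb u (fun a => cov (link c1 a) v)).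
  apply: eq_bigr => a _; rewrite /cov big_distrr /=.
  apply: eq_big_seq => B /(allP (proper_link _ _)) injB.
  by rewrite subset2 !mem_cone // eqxx eq_sym; case: c1.
rewrite (side c) // setUC (side (~~ c)) ?negbK //.
have := cov_link c x y; have := cov_link (~~ c) y x.
by rewrite [h y == _]eq_sym; case: c (h x == h y) => [] [] /=; lia.
Qed.

Lemma size_link (c : bool) (x : X) : 10 * size (link c x) = #|X| * #|X|.-1.
Proof.
have sz : \sum_y cov (link c x) y = size (link c x) * 5.
  rewrite exchange_big /=; under eq_bigr => B _ do rewrite sum_occ.
  by rewrite big_const_seq count_predT iter_addn_0 mulnC.
have e : (\sum_y cov (link c x) y).*2 + #|X| * 2
    = #|X| * #|X| + (\sum_y (h y == (c == h x))).*2.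
  rewrite -!muln2 -!sum_nat_const !big_distrl -!big_split /=.
  apply: eq_bigr => y _; have := cov_link c x y.
  by case: {sz}c (h x) (h y) => [] [] []; rewrite /= -?muln2; lia.
move: e; rewrite (sum_halves _ inj_f h_f) sz.
by case: #|X| => [|m] /= e; nia.
Qed.

(** With [N = #|X|], the point is the apex of [N(N - 1)/10] blocks and a base point of [N(N - 1)/2]
    blocks. *)
Lemma degree_point (c : bool) (x : X) :
  10 * degree design [set (c, x)] = 6 * (#|X| * #|X|.-1).
Proof.
rewrite (degree_side c).
have -> : \sum_a \sum_(B <- link c a) ([set (c, x)] \subset cone c a B)
    = size (link c x).
  rewrite -[RHS](sum_eqb x (fun a => size (link c a))); apply: eq_bigr => a _.
  rewrite -sum1_size big_distrr /=.
  apply: eq_big_seq => B /(allP (proper_link _ _)) injB.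
  by rewrite sub1set mem_cone // eqxx muln1 eq_sym.
have -> : \sum_a \sum_(B <- link (~~ c) a) ([set (c, x)] \subset cone (~~ c) a B)
    = \sum_a cov (link (~~ c) a) x.
  apply: eq_bigr => a _; apply: eq_big_seq => B /(allP (proper_link _ _)) injB.
  by rewrite sub1set mem_cone //; case: c.
have := sum_cov_link (~~ c) x; have := size_link c x; lia.
Qed.

Lemma notin_cone c a (B : block X) :
  (c, a) \notin [set (~~ c, B i) | i : 'I_5].
Proof. by apply/imsetP => -[i _ []]; case: c. Qed.

Lemma card_base c (B : block X) :
  injectiveb B -> #|[set (~~ c, B i) | i : 'I_5]| = 5.
Proof. by move=> /injectiveP injB; rewrite card_imset ?card_ord // => i j [/injB]. Qed.

Lemma cone_own_group c a (B : block X) : cone c a B :&: group_of c = [set (c, a)].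
Proof.
apply/setP => p; rewrite !inE; case: eqP => [->|_] /=; first by rewrite eqxx.
by apply/negbTE/andP => -[/imsetP[i _ ->]] /=; case: c.
Qed.

Lemma cone_other_group c a (B : block X) :
  cone c a B :&: group_of (~~ c) = [set (~~ c, B i) | i : 'I_5].
Proof.
apply/setP => p; rewrite !inE; case: eqP => [->|_] /=.
  by rewrite (negbTE (notin_cone c a B)); case: c.
by apply: andb_idr => /imsetP[i _ ->].
Qed.

Lemma mem_design b : b \in design ->
  exists (c : bool) (a : X) (B : block X), injectiveb B /\ b = cone c a B.
Proof.
rewrite mem_cat => /orP[] /allpairsPdep[a [B [_ Bl ->]]].
  by exists true, a, B; rewrite (allP (proper_link _ _) _ Bl).
by exists false, a, B; rewrite (allP (proper_link _ _) _ Bl).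
Qed.

Lemma card_group_of c : #|group_of c| = #|X|.
Proof.
rewrite (_ : group_of c = [set (c, x) | x : X]).
  by rewrite card_imset // => x y [].
apply/setP => -[d x]; rewrite inE /=.
by apply/eqP/imsetP => [->|[y _ [-> _]]] //; exists x.
Qed.

Lemma halved_GDD : 0 < #|X| ->
  exists (T : finType) (P : {set {set T}}) (B : seq {set T}),
    is_GDD #|X| 2 6 (2 * #|X|) (#|X| - 1) P B /\ has_configuration 1 5 P B.
Proof.
move=> X_gt0; have /card_gt0P[x0 _] := X_gt0.
pose P := [set group_of c | c : bool].
have inj_group : injective group_of.
  by move=> c d /setP/(_ (c, x0)); rewrite !inE eqxx => /esym/eqP.
have memP G : G \in P -> exists c, G = group_of c.
  by case/imsetP => c _ ->; exists c.
exists (bool * X)%type, P, design; split; last first.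
  move=> _ /mem_design[c [a [B [injB ->]]]].
  exists (group_of c), (group_of (~~ c)); rewrite cone_own_group cone_other_group.
  split; rewrite ?cards1 ?card_base ?imset_f // (inj_eq inj_group).
  by case: (c).
split=> [|||G|b|||].
- by rewrite card_prod card_bool.
- apply/and3P; split.
  + apply/eqP/setP => p; rewrite inE; apply/bigcupP.
    by exists (group_of p.1); rewrite ?imset_f ?inE.
  + apply/trivIsetP => _ _ /memP[c ->] /memP[d ->].
    rewrite (inj_eq inj_group) => ncd; rewrite -setI_eq0; apply/eqP/setP => p.
    by rewrite !inE; case: eqP => // ->; apply/negbTE.
  by apply/negP => /memP[c /setP/(_ (c, x0))]; rewrite !inE eqxx.
- by rewrite card_imset // card_bool.
- by case/memP => c ->; apply: card_group_of.
- case/mem_design => c [a [B [injB ->]]].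
  by rewrite cardsU1 notin_cone card_base.
(* The division is exact by [degree_point]. *)
- exists ((6 * (#|X| * #|X|.-1)) %/ 10) => -[c x].
  by rewrite -(degree_point c x) mulKn.
- move=> _ [c1 x] [c2 y] /memP[c ->]; rewrite !inE /= => /eqP-> /eqP-> nxy.
  by apply: degree_same; apply: contraNneq nxy => ->.
move=> _ _ [c1 x] [c2 y] /memP[c ->] /memP[d ->].
rewrite (inj_eq inj_group) !inE /= => ncd /eqP-> /eqP->.
have -> : d = ~~ c by case: c d ncd => [] [].
exact: degree_cross.
Qed.

End Construction.

Theorem theorem7p3 (n : nat) (n_gt0 : 0 < n) (n_mod10 : n = 0 %[mod 10])
    (n_neq10 : n <> 10) (n_neq160 : n <> 160) (n_neq190 : n <> 190) :
  exists (X : finType) (P : {set {set X}}) (B : seq {set X}),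
    is_GDD n 2 6 (2 * n) (n - 1) P B /\ has_configuration 1 5 P B.
Proof.
have /dvdnP[m nm] : 10 %| n by rewrite /dvdn n_mod10.
have [|X [cardX [h [f [L [injf hf prL covL pairL]]]] _]] := @good_order_all m.
  by move: n_gt0; rewrite nm; case: m {nm}.
have -> : n = #|X| by rewrite cardX nm mulnC.
by apply: (halved_GDD injf hf prL covL pairL); rewrite cardX mulnC -nm.
Qed.
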